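(* Let $A\in\mathbb{R}^{m\times n}$ with $m\ge n$ have full column rank, let $b\in\mathbb{R}^m$, $x_0=0$, and let nonsingular preconditioners $L_i\in\mathbb{R}^{n\times n}$, $i=1,2,\dots,k$, be given. Then, in exact arithmetic, the $k$th iterate of FLSMR (applied to $A$, $b$ with preconditioners $L_1,\dots,L_k$ and initial guess $0$) is equal to the $k$th iterate of FGMRES applied to the normal equations $$A^\top A x=A^\top b$$ with the same preconditioners $L_1,\dots,L_k$ and initial guess $0$. (FLSMR and FGMRES are defined in the context.)
   Context: All arithmetic is exact and over the reals; $\|\cdot\|_2$ is the Euclidean norm; $e_1$ is the first column of the identity matrix of order $k+1$. It is assumed that no breakdown occurs in either process below, i.e. all normalization constants that are divided by are nonzero. Flexible Golub–Kahan (FGK) process with $x_0=0$. Let $\beta_1=\|b\|_2$ and $u_1=b/\beta_1$. For $i=1,2,\dots$: 1. $w=A^\top u_i$; $t_{ji}=w^\top v_j$ for $j=1,\dots,i-1$; replace $w$ by $w-\sum_{j=1}^{i-1}t_{ji}v_j$; set $t_{ii}=\|w\|_2$ and $v_i=w/t_{ii}$. 2. $z_i=L_i^{-1}v_i$; $w=Az_i$; $m_{ji}=w^\top u_j$ for $j=1,\dots,i$; replace $w$ by $w-\sum_{j=1}^{i}m_{ji}u_j$; set $m_{i+1,i}=\|w\|_2$ and $u_{i+1}=w/m_{i+1,i}$. The process after $k$ steps consists of steps 1–2 for $i=1,\dots,k$, together with step 1 for $i=k+1$ (which produces $v_{k+1}$ and the entries $t_{j,k+1}$). Put $Z_k=[z_1,\dots,z_k]\in\mathbb{R}^{n\times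 k}$, $U_{k+1}=[u_1,\dots,u_{k+1}]$, $V_{k+1}=[v_1,\dots,v_{k+1}]$ (the last two have orthonormal columns). Let $M_k\in\mathbb{R}^{(k+1)\times k}$ be the upper Hessenberg matrix with entries $m_{ji}$ ($j\le i+1$), zero otherwise, and $T_{k+1}\in\mathbb{R}^{(k+1)\times(k+1)}$ the upper triangular matrix with entries $t_{ji}$ ($j\le i$), zero otherwise. The process yields $AZ_k=U_{k+1}M_k$ and $A^\top U_{k+1}=V_{k+1}T_{k+1}$. FLSMR: the $k$th FLSMR iterate is $x_k=Z_ky_k$ with $y_k=\arg\min_{y\in\mathbb{R}^k}\|T_{k+1}M_ky-\beta_1t_{11}e_1\|_2^2$. FGMRES applied to $A^\top Ax=A^\top b$ with initial guess $0$ and preconditioners $L_i$ (flexible Arnoldi): let $\widehat v_1=A^\top b/\|A^\top b\|_2$. For $i=1,\dots,k$: $\widehat z_i=L_i^{-1}\widehat v_i$; $w=A^\top A\widehat z_i$; $\widehat h_{ji}=w^\top\widehat v_j$ for $j=1,\dots,i$; replace $w$ by $w-\sum_{j=1}^i\widehat h_{ji}\widehat v_j$; set $\widehat h_{i+1,i}=\|w\|_2$ and $\widehat v_{i+1}=w/\widehat h_{i+1,i}$. With $\widehat Z_k=[\widehat z_1,\dots,\widehat z_k]$, $\widehat V_{k+1}=[\widehat v_1,\dots,\widehat v_{k+1}]$ (orthonormal columns) and $\widehat H_k\in\mathbb{R}^{(k+1)\times k}$ the upper Hessenberg matrix of the $\widehat h_{ji}$, one has $A^\top A\widehat Z_k=\widehat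 V_{k+1}\widehat H_k$. The $k$th FGMRES iterate is $\widehat x_k=\widehat Z_k\widehat y_k$ with $\widehat y_k=\arg\min_{y\in\mathbb{R}^k}\big\|\widehat H_ky-\|A^\top b\|_2\,e_1\big\|_2^2$. *)

(* Defs.v *)
From HB Require Import structures.
From mathcomp Require Import all_boot all_order all_algebra.
From mathcomp Require Import boolp classical_sets reals.

Set Implicit Arguments.
Unset Strict Implicit.
Unset Printing Implicit Defensive.

Import Order.TTheory GRing.Theory Num.Theory.
Local Open Scope ring_scope.

(* All sequences are indexed from 0: [fgk_u i], [fgk_v i], [fgk_z i], [L i] are
   the vectors u_(i+1), v_(i+1), z_(i+1) and the preconditioner L_(i+1), and
   likewise for the coefficients t, m and h. *)

Section Euclidean.
Context {R : realType}.

Definition dotv p (x y : 'cV[R]_p) : R := (x^T *m y) 0 0.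

Definition norm2 p (x : 'cV[R]_p) : R := Num.sqrt (dotv x x).

Definition normalize p (w : 'cV[R]_p) : 'cV[R]_p := (norm2 w)^-1 *: w.

(* Every coefficient <w, q> is taken with the original w. *)
Definition orthogonalize p (w : 'cV[R]_p) (s : seq 'cV[R]_p) : 'cV[R]_p :=
  w - \sum_(q <- s) dotv w q *: q.

Definition is_lsq_min p q (B : 'M[R]_(p, q)) (c : 'cV[R]_p) (y : 'cV[R]_q) :
    Prop :=
  forall y' : 'cV[R]_q, norm2 (B *m y - c) ^+ 2 <= norm2 (B *m y' - c) ^+ 2.

(* [xget] selects a point of the set of minimizers. *)
Definition argmin_lsq p q (B : 'M[R]_(p, q)) (c : 'cV[R]_p) : 'cV[R]_q :=
  xget 0 [set y | is_lsq_min B c y]%classic.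

Definition e1 k : 'cV[R]_k.+1 := delta_mx 0 0.

End Euclidean.

Section FlexibleGolubKahan.
Context {R : realType} {m n : nat}.
Implicit Types (A : 'M[R]_(m, n)) (b : 'cV[R]_m) (L : nat -> 'M[R]_n).

(* [fgk_basis A b L k] is ([:: u_1; ..; u_(k+1)], [:: v_1; ..; v_(k+1)]) in
   numbering from 1: the process after k steps, including the final half step
   that produces v_(k+1). *)
Fixpoint fgk_basis A b L (i : nat) : seq 'cV[R]_m * seq 'cV[R]_n :=
  if i is j.+1 then
    let: (us, vs) := fgk_basis A b L j in
    let z := invmx (L j) *m last 0 vs in
    let u := normalize (orthogonalize (A *m z) us) in
    let v := normalize (orthogonalize (A^T *m u) vs) in
    (rcons us u, rcons vs v)
  else
    let u := normalize b in ([:: u], [:: normalize (A^T *m u)]).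

Definition fgk_u A b L (i : nat) : 'cV[R]_m := last 0 (fgk_basis A b L i).1.

Definition fgk_v A b L (i : nat) : 'cV[R]_n := last 0 (fgk_basis A b L i).2.

Definition fgk_z A b L (i : nat) : 'cV[R]_n := invmx (L i) *m fgk_v A b L i.

Definition fgk_t A b L (j i : nat) : R :=
  let w := A^T *m fgk_u A b L i in
  if (j < i)%N then dotv w (fgk_v A b L j)
  else if j == i then norm2 (orthogonalize w (mkseq (fgk_v A b L) i))
  else 0.

Definition fgk_m A b L (j i : nat) : R :=
  let w := A *m fgk_z A b L i in
  if (j <= i)%N then dotv w (fgk_u A b L j)
  else if j == i.+1 then norm2 (orthogonalize w (mkseq (fgk_u A b L) i.+1))
  else 0.

Definition fgk_Z A b L (k : nat) : 'M[R]_(n, k) :=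
  \matrix_(r, i) fgk_z A b L i r 0.

Definition fgk_T A b L (k : nat) : 'M[R]_k :=
  \matrix_(j, i) fgk_t A b L j i.

Definition fgk_M A b L (k : nat) : 'M[R]_(k.+1, k) :=
  \matrix_(j, i) fgk_m A b L j i.

Definition fgk_no_breakdown A b L (k : nat) : Prop :=
  [/\ norm2 b != 0,
      (forall i : nat, (i <= k)%N -> fgk_t A b L i i != 0)
    & (forall i : nat, (i < k)%N -> fgk_m A b L i.+1 i != 0)].

Definition flsmr_iterate A b L (k : nat) : 'cV[R]_n :=
  fgk_Z A b L k *m
    argmin_lsq (fgk_T A b L k.+1 *m fgk_M A b L k)
               ((norm2 b * fgk_t A b L 0 0) *: e1 k).

Lemma fgk_basisE A b L i :
  fgk_basis A b L i = (mkseq (fgk_u A b L) i.+1, mkseq (fgk_v A b L) i.+1).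
Proof.
elim: i => [//|i IHi]; rewrite !(mkseqS _ i.+1) [fgk_u _ _ _ i.+1]/fgk_u.
by rewrite [fgk_v _ _ _ i.+1]/fgk_v /= IHi /= !last_rcons.
Qed.

Lemma fgk_u0 A b L : fgk_u A b L 0 = (norm2 b)^-1 *: b.
Proof. by []. Qed.

Lemma orthogonalize_mkseq p (w : 'cV[R]_p) (f : nat -> 'cV[R]_p) i :
  orthogonalize w (mkseq f i) = w - \sum_(j < i) dotv w (f j) *: f j.
Proof.
by rewrite /orthogonalize /mkseq big_map -{1}(subn0 i) -/(index_iota 0 i) big_mkord.
Qed.

Lemma fgk_vE A b L i :
  fgk_v A b L i = (fgk_t A b L i i)^-1 *:
    (A^T *m fgk_u A b L i - \sum_(j < i) fgk_t A b L j i *: fgk_v A b L j).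
Proof.
rewrite [fgk_t _ _ _ i i]/fgk_t ltnn eqxx /= (eq_bigr (fun j : 'I_i =>
  dotv (A^T *m fgk_u A b L i) (fgk_v A b L j) *: fgk_v A b L j)); last first.
  by move=> j _; rewrite /fgk_t ltn_ord.
rewrite -orthogonalize_mkseq -/(normalize _).
case: i => [|i]; first by rewrite /fgk_v /fgk_u /orthogonalize /= big_nil subr0.
by rewrite {1}/fgk_v /fgk_u /= fgk_basisE /= !last_rcons.
Qed.

Lemma fgk_uE A b L i :
  fgk_u A b L i.+1 = (fgk_m A b L i.+1 i)^-1 *:
    (A *m fgk_z A b L i - \sum_(j < i.+1) fgk_m A b L j i *: fgk_u A b L j).
Proof.
rewrite [fgk_m _ _ _ i.+1 i]/fgk_m ltnn eqxx /= (eq_bigr (fun j : 'I_i.+1 =>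
  dotv (A *m fgk_z A b L i) (fgk_u A b L j) *: fgk_u A b L j)); last first.
  by move=> j _; rewrite /fgk_m -ltnS ltn_ord.
rewrite -orthogonalize_mkseq -/(normalize _).
rewrite {1}/fgk_u /fgk_z {1}/fgk_v /=.
by case E: (fgk_basis A b L i) => [us vs] /=; rewrite last_rcons;
  move: E; rewrite fgk_basisE => -[<- _].
Qed.

End FlexibleGolubKahan.

Section FlexibleGMRES.
Context {R : realType} {n : nat}.
Implicit Types (B : 'M[R]_n) (c : 'cV[R]_n) (L : nat -> 'M[R]_n).

(* FGMRES for a square system B x = c with initial guess 0. *)
Fixpoint arnoldi_basis B c L (i : nat) : seq 'cV[R]_n :=
  if i is j.+1 then
    let vs := arnoldi_basis B c L j in
    let z := invmx (L j) *m last 0 vs in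
    rcons vs (normalize (orthogonalize (B *m z) vs))
  else [:: normalize c].

Definition arnoldi_v B c L (i : nat) : 'cV[R]_n := last 0 (arnoldi_basis B c L i).

Definition arnoldi_z B c L (i : nat) : 'cV[R]_n :=
  invmx (L i) *m arnoldi_v B c L i.

Definition arnoldi_h B c L (j i : nat) : R :=
  let w := B *m arnoldi_z B c L i in
  if (j <= i)%N then dotv w (arnoldi_v B c L j)
  else if j == i.+1 then norm2 (orthogonalize w (mkseq (arnoldi_v B c L) i.+1))
  else 0.

Definition arnoldi_Z B c L (k : nat) : 'M[R]_(n, k) :=
  \matrix_(r, i) arnoldi_z B c L i r 0.

Definition arnoldi_H B c L (k : nat) : 'M[R]_(k.+1, k) :=
  \matrix_(j, i) arnoldi_h B c L j i.

Definition arnoldi_no_breakdown B c L (k : nat) : Prop :=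
  norm2 c != 0 /\ (forall i : nat, (i < k)%N -> arnoldi_h B c L i.+1 i != 0).

Definition fgmres_iterate B c L (k : nat) : 'cV[R]_n :=
  arnoldi_Z B c L k *m argmin_lsq (arnoldi_H B c L k) (norm2 c *: e1 k).

Lemma arnoldi_basisE B c L i :
  arnoldi_basis B c L i = mkseq (arnoldi_v B c L) i.+1.
Proof.
elim: i => [//|i IHi].
by rewrite mkseqS -IHi [arnoldi_v _ _ _ i.+1]/arnoldi_v /= last_rcons.
Qed.

Lemma arnoldi_v0 B c L : arnoldi_v B c L 0 = (norm2 c)^-1 *: c.
Proof. by []. Qed.

Lemma arnoldi_vE B c L i :
  arnoldi_v B c L i.+1 = (arnoldi_h B c L i.+1 i)^-1 *:
    (B *m arnoldi_z B c L i
     - \sum_(j < i.+1) arnoldi_h B c L j i *: arnoldi_v B c L j).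
Proof.
rewrite [arnoldi_h _ _ _ i.+1 i]/arnoldi_h ltnn eqxx /= (eq_bigr (fun j : 'I_i.+1 =>
  dotv (B *m arnoldi_z B c L i) (arnoldi_v B c L j) *: arnoldi_v B c L j)).
  rewrite -orthogonalize_mkseq -/(normalize _) {1}/arnoldi_v /= last_rcons.
  by rewrite -arnoldi_basisE.
by move=> j _; rewrite /arnoldi_h -ltnS ltn_ord.
Qed.

End FlexibleGMRES.

(* Main.v *)
Require Import Defs.
From mathcomp Require Import all_boot all_order all_algebra.
From mathcomp Require Import reals.
Local Open Scope ring_scope.

(** Both processes orthonormalize successive vectors against all previous ones.
    The vectors [A^T u_i] and [A^T A z_(i-1)] differ by a positive factor and
    by a combination of [A^T u_1, .., A^T u_(i-1)], which already lie in the
    span of [v_1, .., v_(i-1)]; hence the two processes build the same basis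
    [v_i], and so the same [z_i].  Then
    [V T M = A^T U M = A^T A Z = V H], and [V^T V = 1] gives [T M = H]: the two
    least squares problems have identical data. *)

Import Order.TTheory GRing.Theory Num.Theory.

(** * Inner products, normalization and Gram-Schmidt in coordinates *)

Section GramSchmidt.
Context {R : realType} {p : nat}.
Implicit Types (x y w : 'cV[R]_p) (f : nat -> 'cV[R]_p) (a : R).

Lemma dotvC x y : dotv x y = dotv y x.
Proof. by rewrite /dotv !mxE; apply: eq_bigr => i _; rewrite !mxE mulrC. Qed.

Lemma dotvDl x y w : dotv (x + y) w = dotv x w + dotv y w.
Proof. by rewrite /dotv linearD /= mulmxDl mxE. Qed.

Lemma dotvZl a x w : dotv (a *: x) w = a * dotv x w.
Proof. by rewrite /dotv linearZ /= -scalemxAl mxE. Qed.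

Lemma dotvBl x y w : dotv (x - y) w = dotv x w - dotv y w.
Proof. by rewrite -scaleN1r dotvDl dotvZl mulN1r. Qed.

Lemma dotv0l w : dotv 0 w = 0.
Proof. by rewrite -(scale0r w) dotvZl mul0r. Qed.

Lemma dotv_suml I (r : seq I) (P : pred I) (g : I -> 'cV[R]_p) w :
  dotv (\sum_(i <- r | P i) g i) w = \sum_(i <- r | P i) dotv (g i) w.
Proof.
by apply: (big_morph (fun x => dotv x w)) => [x y|]; rewrite ?dotvDl ?dotv0l.
Qed.

Lemma dotv_ge0 x : 0 <= dotv x x.
Proof.
rewrite /dotv mxE; apply: sumr_ge0 => i _.
by rewrite mxE -expr2 sqr_ge0.
Qed.

Lemma norm2Z a x : 0 <= a -> norm2 (a *: x) = a * norm2 x.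
Proof.
move=> a_ge0; rewrite /norm2 dotvZl dotvC dotvZl mulrA -expr2.
by rewrite sqrtrM ?sqr_ge0 // sqrtr_sqr ger0_norm.
Qed.

Lemma normalizeZ a x : 0 < a -> normalize (a *: x) = normalize x.
Proof.
move=> a_gt0; rewrite /normalize norm2Z ?ltW // scalerA invfM.
by rewrite mulrAC mulVf ?gt_eqF // mul1r.
Qed.

Lemma dotv_normalize x : norm2 x != 0 -> dotv (normalize x) (normalize x) = 1.
Proof.
move=> x_neq0; rewrite /normalize dotvZl dotvC dotvZl.
rewrite -[dotv x x]sqr_sqrtr ?dotv_ge0 // -/(norm2 x) expr2.
by rewrite !mulrA divfK // mulVf.
Qed.

Lemma orthogonalizeZ a w (s : seq 'cV[R]_p) :
  orthogonalize (a *: w) s = a *: orthogonalize w s.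
Proof.
rewrite /orthogonalize scalerBr scaler_sumr; congr (_ - _).
by apply: eq_bigr => q _; rewrite dotvZl scalerA.
Qed.

Lemma orthogonalizeB x y (s : seq 'cV[R]_p) :
  orthogonalize (x - y) s = orthogonalize x s - orthogonalize y s.
Proof.
rewrite /orthogonalize; under eq_bigr do rewrite dotvBl scalerBl.
by rewrite sumrB !opprD !opprK addrACA.
Qed.

(** By orthonormality the projection coefficients of the sum are the [a j] themselves, so the whole
    sum is subtracted. This discards the part of a new direction that lies in the span already
    built. *)
Lemma orthogonalize_span f i (a : nat -> R) :
  (forall j j', (j < i)%N -> (j' < i)%N -> dotv (f j) (f j') = (j == j')%:R) ->
  orthogonalize (\sum_(j < i) a j *: f j) (mkseq f i) = 0.
Proof.
move=> f_on; rewrite orthogonalize_mkseq.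
apply/eqP; rewrite subr_eq0; apply/eqP/eq_bigr => j _.
rewrite dotv_suml (bigD1 j) //= big1 => [|j' neq_j'j].
  by rewrite dotvZl f_on // eqxx mulr1 addr0.
by rewrite dotvZl f_on // (negPf (neq_j'j : _ != _ :> nat)) mulr0.
Qed.

Lemma gram_schmidt_orthonormal f (w : nat -> 'cV[R]_p) k :
  (forall i, (i < k)%N -> f i = normalize (orthogonalize (w i) (mkseq f i))) ->
  (forall i, (i < k)%N -> norm2 (orthogonalize (w i) (mkseq f i)) != 0) ->
  forall i j, (i < k)%N -> (j < k)%N -> dotv (f i) (f j) = (i == j)%:R.
Proof.
elim: k => // k IHk f_def f_neq0.
have {}IHk : forall i j, (i < k)%N -> (j < k)%N -> dotv (f i) (f j) = (i == j)%:R.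
  by apply: IHk => i lt_ik; [apply: f_def | apply: f_neq0]; apply: ltnW.
(* The only new pairs involve [f k]. Against [f j] a single projection term survives, and it cancels
   [dotv (w k) (f j)]. *)
have f_kl j : (j < k)%N -> dotv (f k) (f j) = 0.
  move=> lt_jk; rewrite f_def // dotvZl.
  suff -> : dotv (orthogonalize (w k) (mkseq f k)) (f j) = 0 by rewrite mulr0.
  rewrite orthogonalize_mkseq dotvBl dotv_suml (bigD1 (Ordinal lt_jk)) //=.
  rewrite dotvZl IHk // eqxx mulr1 big1 => [|i neq_ij].
    by rewrite addr0 subrr.
  by rewrite dotvZl IHk // (negPf (neq_ij : _ != _ :> nat)) mulr0.
move=> i j; rewrite !ltnS (leq_eqVlt i) (leq_eqVlt j).
case/predU1P=> [->|lt_ik] /predU1P[->|lt_jk].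
- by rewrite eqxx f_def // dotv_normalize ?f_neq0.
- by rewrite f_kl // gtn_eqF.
- by rewrite dotvC f_kl // ltn_eqF.
- exact: IHk.
Qed.

(** Solving the normalized recurrence for [w] gives a sum up to [i]; vanishing coefficients beyond
    [i] pad it to any length [l], as a full column of a triangular or Hessenberg matrix requires. *)
Lemma recurrence_expansion f w (c : nat -> R) i l :
  f i = (c i)^-1 *: (w - \sum_(j < i) c j *: f j) -> c i != 0 ->
  (forall j, (i < j)%N -> c j = 0) -> (i < l)%N ->
  w = \sum_(j < l) c j *: f j.
Proof.
move=> f_i ci_neq0 c_gt lt_il.
have -> : w = \sum_(j < i.+1) c j *: f j.
  by rewrite big_ord_recr /= f_i scalerA mulfV // scale1r addrC subrK.
rewrite (big_ord_widen l (fun j => c j *: f j)) // big_mkcond /=.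
by apply: eq_bigr => j _; case: ltnP => // /c_gt->; rewrite scale0r.
Qed.

Definition cols_mx f k : 'M[R]_(p, k) := \matrix_(r, i) f i r 0.

(** Turns column-by-column expansions into matrix relations such as [A^T U = V T] and
    [A Z = U M]. *)
Lemma cols_mxM f g (c : nat -> nat -> R) k l :
  (forall i, (i < k)%N -> g i = \sum_(j < l) c j i *: f j) ->
  cols_mx g k = cols_mx f l *m \matrix_(j, i) c j i.
Proof.
move=> g_def; apply/matrixP=> r i; rewrite !mxE g_def // summxE.
by apply: eq_bigr => j _; rewrite !mxE mulrC.
Qed.

Lemma trmx_cols_mxK f k :
  (forall i j, (i < k)%N -> (j < k)%N -> dotv (f i) (f j) = (i == j)%:R) ->
  (cols_mx f k)^T *m cols_mx f k = 1%:M.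
Proof.
move=> f_on; apply/matrixP=> i j; rewrite !mxE -(f_on i j) // /dotv mxE.
by apply: eq_bigr => r _; rewrite !mxE.
Qed.

End GramSchmidt.

Lemma mulmx_cols_mx {R : realType} p q (B : 'M[R]_(q, p)) (f : nat -> 'cV[R]_p) k :
  B *m cols_mx f k = cols_mx (fun i => B *m f i) k.
Proof.
by apply/matrixP=> r i; rewrite !mxE; apply: eq_bigr => j _; rewrite !mxE.
Qed.

(** * Golub-Kahan against Arnoldi on the normal equations *)

Section Comparison.
Context {R : realType} {m n : nat} {A : 'M[R]_(m, n)} {b : 'cV[R]_m}.
Context {k : nat} {L : nat -> 'M[R]_n}.

Local Notation u := (fgk_u A b L).
Local Notation v := (fgk_v A b L).
Local Notation z := (fgk_z A b L).
Local Notation t := (fgk_t A b L).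
Local Notation mm := (fgk_m A b L).
Local Notation B := (A^T *m A).
Local Notation c := (A^T *m b).
Local Notation v' := (arnoldi_v B c L).
Local Notation z' := (arnoldi_z B c L).
Local Notation h := (arnoldi_h B c L).

Lemma fgk_v_normalize i : v i = normalize (orthogonalize (A^T *m u i) (mkseq v i)).
Proof.
rewrite fgk_vE /normalize orthogonalize_mkseq; congr (_ *: (_ - _)).
  by rewrite /fgk_t ltnn eqxx orthogonalize_mkseq.
by apply: eq_bigr => j _; rewrite /fgk_t ltn_ord.
Qed.

Lemma arnoldi_v_normalize i :
  v' i.+1 = normalize (orthogonalize (B *m z' i) (mkseq v' i.+1)).
Proof.
rewrite arnoldi_vE /normalize orthogonalize_mkseq; congr (_ *: (_ - _)).
  by rewrite /arnoldi_h ltnn eqxx orthogonalize_mkseq.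
by apply: eq_bigr => j _; rewrite /arnoldi_h -ltnS ltn_ord.
Qed.

Context (fgk_ok : fgk_no_breakdown A b L k).

Lemma norm2_rhs_gt0 : 0 < norm2 b.
Proof. by have [b_neq0 _ _] := fgk_ok; rewrite lt0r b_neq0 sqrtr_ge0. Qed.

(** The sign matters: normalization absorbs a positive factor, while a negative one would flip the
    basis vector. *)
Lemma fgk_m_gt0 i : (i < k)%N -> 0 < mm i.+1 i.
Proof.
have [_ _ m_neq0] := fgk_ok => /m_neq0 mi_neq0; rewrite lt0r mi_neq0.
by rewrite /fgk_m ltnn eqxx sqrtr_ge0.
Qed.

Lemma fgk_v_orthonormal i j :
  (i <= k)%N -> (j <= k)%N -> dotv (v i) (v j) = (i == j)%:R.
Proof.
apply: (@gram_schmidt_orthonormal _ _ v (fun i => A^T *m u i) k.+1) => {i j}.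
  by move=> i _; apply: fgk_v_normalize.
by have [_ t_neq0 _] := fgk_ok => i /t_neq0; rewrite /fgk_t ltnn eqxx.
Qed.

Lemma trmx_fgk_u_expansion i l : (i <= k)%N -> (i < l)%N ->
  A^T *m u i = \sum_(j < l) t j i *: v j.
Proof.
have [_ t_neq0 _] := fgk_ok => le_ik lt_il.
apply: (@recurrence_expansion _ _ v _ (t^~ i)) lt_il; rewrite ?t_neq0 ?fgk_vE //.
by move=> j lt_ij; rewrite /fgk_t ltnNge ltnW //= gtn_eqF.
Qed.

Lemma fgk_z_expansion i l : (i < k)%N -> (i.+1 < l)%N ->
  A *m z i = \sum_(j < l) mm j i *: u j.
Proof.
have [_ _ m_neq0] := fgk_ok => lt_ik lt_il.
apply: (@recurrence_expansion _ _ u _ (mm^~ i)) lt_il; rewrite ?m_neq0 ?fgk_uE //.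
by move=> j lt_ij; rewrite /fgk_m leqNgt ltnW //= gtn_eqF.
Qed.

(** Strong induction, since each step orthogonalizes against all earlier vectors. At the start,
    [A^T u_1] is a positive multiple of [A^T b]. *)
Lemma fgk_v_arnoldi_v i : (i <= k)%N -> v i = v' i.
Proof.
elim/ltn_ind: i => -[_ _|i IHi lt_ik].
  rewrite fgk_v_normalize arnoldi_v0 fgk_u0 /orthogonalize big_nil subr0.
  by rewrite -scalemxAr normalizeZ // invr_gt0 norm2_rhs_gt0.
have eq_seq : mkseq v' i.+1 = mkseq v i.+1.
  apply/eq_in_map => j; rewrite mem_iota add0n => lt_ji.
  by rewrite IHi // ltnW // (leq_trans lt_ji).
have eq_z : z' i = z i by rewrite /arnoldi_z /fgk_z IHi // ltnW.
rewrite arnoldi_v_normalize eq_seq eq_z fgk_v_normalize fgk_uE -scalemxAr.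
rewrite orthogonalizeZ normalizeZ ?invr_gt0 ?fgk_m_gt0 // mulmxBr mulmxA.
rewrite orthogonalizeB mulmx_sumr.
(* The coordinates on the [v l] of the terms subtracted in forming [u i.+1], once mapped by [A^T]:
   expand every [A^T *m u j] to the common length [i.+1] and exchange the two sums. *)
pose a l := \sum_(j < i.+1) mm j i * t l j.
suff -> : \sum_(j < i.+1) A^T *m (mm j i *: u j) = \sum_(l < i.+1) a l *: v l.
  rewrite (@orthogonalize_span _ _ v i.+1 a) ?subr0 // => j j' le_ji le_j'i.
  by apply: fgk_v_orthonormal; apply: leq_trans lt_ik; apply: ltnW.
under [RHS]eq_bigr do rewrite scaler_suml.
rewrite exchange_big; apply: eq_bigr => j _.
rewrite -scalemxAr (@trmx_fgk_u_expansion j i.+1) ?scaler_sumr //; last first.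
  by apply: leq_trans lt_ik; apply: ltnW.
by apply: eq_bigr => l _; rewrite scalerA.
Qed.

Lemma fgk_Z_arnoldi_Z : fgk_Z A b L k = arnoldi_Z B c L k.
Proof.
apply/matrixP=> r i; rewrite !mxE /fgk_z /arnoldi_z fgk_v_arnoldi_v //.
exact: ltnW.
Qed.

(** Matches the right-hand sides of the two least squares problems: [t 0 0] is the norm of [A^T b]
    divided by that of [b]. *)
Lemma norm2_normal_rhs : norm2 b * t 0 0 = norm2 c.
Proof.
rewrite /fgk_t ltnn eqxx /orthogonalize big_nil subr0 fgk_u0 -scalemxAr.
have b_gt0 := norm2_rhs_gt0.
by rewrite norm2Z ?invr_ge0 ?ltW // mulVKf ?gt_eqF.
Qed.

Context (fgmres_ok : arnoldi_no_breakdown B c L k).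

Lemma arnoldi_z_expansion i l : (i < k)%N -> (i.+1 < l)%N ->
  B *m z' i = \sum_(j < l) h j i *: v' j.
Proof.
have [_ h_neq0] := fgmres_ok => lt_ik lt_il.
apply: (@recurrence_expansion _ _ v' _ (h^~ i)) lt_il; rewrite ?h_neq0 ?arnoldi_vE //.
by move=> j lt_ij; rewrite /arnoldi_h leqNgt ltnW //= gtn_eqF.
Qed.

Lemma fgk_TM_arnoldi_H : fgk_T A b L k.+1 *m fgk_M A b L k = arnoldi_H B c L k.
Proof.
have VTV : (cols_mx v k.+1)^T *m cols_mx v k.+1 = 1%:M.
  by apply: trmx_cols_mxK => i j; apply: fgk_v_orthonormal.
(* Inserting [V^T V] on both sides and stripping [V^T] leaves [V T M = V H]. *)
rewrite -[LHS]mul1mx -[RHS]mul1mx -VTV -!mulmxA; congr (_ *m _).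
rewrite mulmxA -(@cols_mxM _ _ v (fun i => A^T *m u i)) => [|i lt_ik]; last first.
  exact: trmx_fgk_u_expansion.
rewrite -mulmx_cols_mx -mulmxA -(@cols_mxM _ _ u (fun i => A *m z i)) => [|i lt_ik].
  (* The left side is now [A^T A Z]; it remains to read the Arnoldi relation column by column, with
     [z] and [v] in place of [z'] and [v']. *)
  rewrite mulmx_cols_mx -(@cols_mxM _ _ v (fun i => A^T *m (A *m z i))) // => i lt_ik.
  rewrite mulmxA /fgk_z fgk_v_arnoldi_v 1?ltnW // -/(z' i).
  rewrite (@arnoldi_z_expansion i k.+1) //; apply: eq_bigr => j _.
  by rewrite fgk_v_arnoldi_v // -ltnS.
exact: fgk_z_expansion.
Qed.

End Comparison.

Theorem theorem3p2 (R : realType) (m n : nat) (A : 'M[R]_(m, n)) (b : 'cV[R]_m)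
    (k : nat) (L : nat -> 'M[R]_n)
    (le_nm : (n <= m)%N)
    (rankA : \rank A = n)
    (unitL : forall i : nat, (i < k)%N -> L i \in unitmx)
    (fgk_ok : fgk_no_breakdown A b L k)
    (fgmres_ok : arnoldi_no_breakdown (A^T *m A) (A^T *m b) L k) :
  flsmr_iterate A b L k = fgmres_iterate (A^T *m A) (A^T *m b) L k.
Proof.
(* Once matrix and right-hand side agree, both [argmin_lsq] terms coincide and select the same
   minimizer. *)
rewrite /flsmr_iterate /fgmres_iterate fgk_Z_arnoldi_Z //.
by rewrite (@norm2_normal_rhs _ _ _ _ _ _ _ fgk_ok) fgk_TM_arnoldi_H.
Qed.
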